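(* Let $0<\epsilon<\frac15$. Any one-pass streaming algorithm that returns an $(\epsilon,\rho)$-multiplicative solution to the COLOR-DISCREPANCY problem uses $\Omega(n)$ bits of space, where the input stream $\mathcal{P}$ consists of $n$ points.
   Context: COLOR-DISCREPANCY: given a stream $\mathcal{P}$ of $n$ points in $[0,1]$, each labeled red or blue, report the 1-dimensional color discrepancy $$D_c(\mathcal{P}) := \sup_{I\subseteq[0,1]} |R(I)-B(I)|,$$ where $I$ ranges over intervals and $R(I)$, $B(I)$ denote the numbers of red and blue points of $\mathcal{P}$ in $I$. An $(\epsilon,\rho)$-multiplicative solution is an output $D'$ with $|D'-D_c(\mathcal{P})| \le \epsilon D_c(\mathcal{P})$ with probability at least $1-\rho$; here $\rho=\frac13$. A one-pass (insertion-only) streaming algorithm reads the points once, in the (arbitrary) order of the stream, and keeps only a memory state, whose size in bits is the space. *)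

(* Defs.v *)
From HB Require Import structures.
From mathcomp Require Import all_boot all_order all_algebra.
From mathcomp Require Import all_classical all_reals all_analysis.

Set Implicit Arguments.
Unset Strict Implicit.
Unset Printing Implicit Defensive.

Import Order.TTheory GRing.Theory Num.Theory.
Import numFieldNormedType.Exports.

Local Open Scope classical_set_scope.
Local Open Scope ring_scope.

Notation color := bool (only parsing).
Definition red : color := true.
Definition blue : color := false.

Notation point R := (R * color)%type (only parsing).

(* U is the set of positions that points can take: U = [0, 1] gives all streams
   of n points of the unit interval. A finite U gives points of bounded
   precision, for which a bit-string memory can store a stream exactly, whereas
   it cannot store arbitrary reals. A position may be repeated, with the same
   or different colors. *)
Definition streams (R : realType) (U : set R) (n : nat) : set (seq (point R)) :=
  [set s | size s = n /\ forall x, x \in s -> U x.1].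

Definition color_count (R : realType) (c : color) (s : seq (point R))
    (I : interval R) : nat :=
  count (fun x : point R => (x.1 \in I) && (x.2 == c)) s.

(* I ranges over intervals of all kinds (open, closed, half-open, degenerate).
   The set is nonempty and bounded by the length of s, so sup is genuine. *)
Definition color_discrepancy (R : realType) (s : seq (point R)) : R :=
  sup [set `|(color_count red s I)%:R - (color_count blue s I)%:R|
      | I in [set I : interval R | [set` I] `<=` `[0, 1]%classic]].

(* A randomized one-pass algorithm whose memory is a bit string. All random
   choices are determined by an outcome w in Omega, which is not charged to the
   memory. The transition also receives the number of items read so far: this
   lets it draw fresh coins from w at every step, so that algorithms tossing
   private coins (which a time-independent function of w and of the memory
   would not cover) and algorithms with a shared random string are both
   included. *)
Record streaming_algorithm (R : realType) (Omega : Type) := StreamingAlgorithm {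
  sa_init : Omega -> seq bool;
  sa_step : Omega -> nat -> seq bool -> point R -> seq bool;
  sa_output : Omega -> seq bool -> R }.

Fixpoint run_from (R : realType) (Omega : Type)
    (A : streaming_algorithm R Omega) (w : Omega) (t : nat) (m : seq bool)
    (s : seq (point R)) : seq bool :=
  if s is x :: s' then run_from A w t.+1 (sa_step A w t m x) s' else m.

Definition memory (R : realType) (Omega : Type)
    (A : streaming_algorithm R Omega) (w : Omega) (s : seq (point R)) :
    seq bool :=
  run_from A w 0 (sa_init A w) s.

Definition output (R : realType) (Omega : Type)
    (A : streaming_algorithm R Omega) (w : Omega) (s : seq (point R)) : R :=
  sa_output A w (memory A w s).

(* Number of bits in the worst case over the inputs, over the random choices,
   and over the times k at which the memory is observed. *)
Definition space_bits (R : realType) (Omega : Type)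
    (A : streaming_algorithm R Omega) (U : set R) (n : nat) : \bar R :=
  ereal_sup [set b : \bar R | exists (w : Omega) (s : seq (point R)) (k : nat),
    streams U n s /\ b = ((size (memory A w (take k s)))%:R)%:E].

Definition success (R : realType) (Omega : Type)
    (A : streaming_algorithm R Omega) (eps : R) (s : seq (point R)) :
    set Omega :=
  [set w | `|output A w s - color_discrepancy s| <= eps * color_discrepancy s].

(* Measurability is demanded explicitly since a measure is unspecified on
   non-measurable sets. *)
Definition multiplicative_solution (R : realType) (d : measure_display)
    (Omega : measurableType d) (P : probability Omega R)
    (A : streaming_algorithm R Omega) (eps rho : R) (U : set R) (n : nat) :
    Prop :=
  forall s : seq (point R), streams U n s ->
    measurable (success A eps s) /\ ((1 - rho)%:E <= P (success A eps s))%E.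

(* Main.v *)
(* Reduction from INDEX. A bit string x of length m is streamed as m pairs of
   points at increasing positions, the k-th pair being colored red-blue if
   x_k = 1 and blue-red otherwise; a query for bit i then appends two reds at
   the left and two blues at the right point of pair i. If x_i = 1 the left
   point alone has 3 reds, so the discrepancy is at least 3; if x_i = 0 all
   prefix sums of (red - blue) lie in [-1, 1], so it is at most 2. A relative
   error below 1/5 separates 2 from 3, hence the memory after the first m pairs
   lets one guess every bit of x with probability at least 2/3. By averaging,
   one outcome of the coins gives on average over x at least 2m/3 agreements
   between x and the guess y. With m = 3q, comparing the sum of 2^#agreements
   over x, which is at least 2^(2q) 2^(3q) by convexity, with its value 3^(3q)
   for each fixed y shows that there are at least (32/27)^q memory states. *)
Require Import Defs.
From HB Require Import structures.
From mathcomp Require Import all_boot all_order all_algebra.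
From mathcomp Require Import all_classical all_reals all_analysis.
From mathcomp Require Import measurable_realfun.
From mathcomp Require Import ring lra zify.

Set Implicit Arguments.
Unset Strict Implicit.
Unset Printing Implicit Defensive.

Import Order.TTheory GRing.Theory Num.Theory.
Import numFieldNormedType.Exports.

(** * Counting memory states through agreements *)

Lemma sum_exp_agreement (I : finType) (y : {ffun I -> bool}) :
  \sum_(x : {ffun I -> bool}) 2 ^ #|[pred i | x i == y i]| = 3 ^ #|I|.
Proof.
(* Each coordinate gives a factor 2 on agreement and 1 otherwise; distributivity turns the sum of
   products into a product of factors 2 + 1. *)
transitivity (\sum_(x : {ffun I -> bool}) \prod_i (if x i == y i then 2 else 1)).
  apply: eq_bigr => x _.
  by rewrite -big_mkcond /= prod_nat_const.
rewrite -(bigA_distr_bigA (fun i b => if b == y i then 2 else 1)) /=.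
under eq_bigr => i _ do rewrite big_bool.
rewrite (eq_bigr (fun=> 3)) ?prod_nat_const ?cardT //.
by move=> i _; case: (y i).
Qed.

(** Convexity of [2 ^ a]: the chord through the points [k] and [k + 1] stays below at every natural
    [a]. The subtracted term is moved to the right to stay in [nat]. *)
Lemma exp2_tangent (k a : nat) : 2 ^ k * a.+1 <= 2 ^ a + 2 ^ k * k.
Proof.
case: (leqP a k) => [ak|ka].
  move: ak; rewrite leq_eqVlt => /orP [/eqP->|ak].
    by rewrite mulnS.
  by apply: leq_trans (leq_addl _ _); rewrite leq_mul2l ak orbT.
have -> : a = (k + (a - k))%N by rewrite subnKC // ltnW.
rewrite expnD -mulnDr leq_mul2l -addnS addnC leq_add2r ltn_expl //.
by rewrite orbT.
Qed.

(* Stated for variables: on numerals 27 and 32, conversion would evaluate the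
   powers in unary. *)
Lemma double_exp5_le x y :
  7 * x ^ 2 <= 5 * y ^ 2 -> 32 * x <= 27 * y -> 2 * x ^ 5 <= y ^ 5.
Proof.
move=> h1 h2.
have h3 : 49 * x ^ 4 <= 25 * y ^ 4.
  by have := leq_mul h1 h1; rewrite mulnACA [leqRHS]mulnACA -!expnD.
have h4 := leq_mul h3 h2.
(* Here 1568 = 49 * 32 matches the left side of [h4]; what remains is 2 * 25 * 27 = 1350 <= 1568. *)
rewrite -(@leq_pmul2l 1568) //.
have -> : 1568 * (2 * x ^ 5) = 2 * ((49 * x ^ 4) * (32 * x)).
  rewrite (expnSr x 4); lia.
apply: (@leq_trans (2 * (25 * y ^ 4 * (27 * y)))).
  by rewrite leq_pmul2l.
by rewrite (expnSr y 4); lia.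
Qed.

Lemma index_memory_lower_bound (S q : nat) (T : finType)
    (msg : {ffun T -> bool} -> seq bool)
    (guess : seq bool -> {ffun T -> bool}) :
  #|T| = (3 * q)%N ->
  (forall x, size (msg x) <= S)%N ->
  (2 * q * 2 ^ (3 * q) <=
     \sum_(x : {ffun T -> bool}) #|[pred i | x i == guess (msg x) i]|)%N ->
  (q <= 8 * S)%N.
Proof.
move=> cT szm agr.
pose X := {ffun T -> bool}.
pose a (x : X) z := #|[pred i | x i == guess z i]|.
(* Memories of at most S bits are padded with None to length S. *)
pose code z := [tuple nth None (map Some z) k | k < S] : S.-tuple (option bool).
pose decode (t : S.-tuple (option bool)) := pmap id t.
have codeK x : decode (code (msg x)) = msg x.
  rewrite /decode /code /=.
  have -> : [seq nth None [seq Some i | i <- msg x] (nat_of_ord k)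
            | k <- enum 'I_S] =
      [seq Some i | i <- msg x] ++ nseq (S - size (msg x)) None.
    apply: (@eq_from_nth _ None).
      by rewrite size_map size_enum_ord size_cat size_map size_nseq subnKC.
    move=> k; rewrite size_map size_enum_ord => kS.
    rewrite (nth_map (Ordinal kS)) ?size_enum_ord // nth_enum_ord // nth_cat.
    case: ifP => // /negbT; rewrite -leqNgt => h.
    by rewrite nth_default // nth_nseq if_same.
  rewrite pmap_cat -[RHS]cats0; congr (_ ++ _).
    by elim: (msg x) => //= b s ->.
  by elim: (_ - _)%N.
have cX : #|{: X}| = 2 ^ (3 * q) by rewrite card_ffun card_bool cT.
have up : \sum_(x : X) 2 ^ a x (msg x) <= 3 ^ S * 3 ^ (3 * q).
  (* Summing over all codes instead of the actual memory of [x] makes the guess independent of [x],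
     so the sum over [x] can be evaluated first. *)
  apply: (@leq_trans (\sum_(x : X) \sum_(t : S.-tuple (option bool))
                        2 ^ a x (decode t))).
    apply: leq_sum => x _.
    by rewrite (bigD1 (code (msg x))) //= codeK leq_addr.
  rewrite exchange_big /=.
  under eq_bigr => t _ do rewrite sum_exp_agreement.
  by rewrite sum_nat_const card_tuple card_option card_bool cT.
(* The chord is taken at [2 * q], the guaranteed average number of agreements. *)
have lo : 2 ^ (2 * q) * 2 ^ (3 * q) <= \sum_(x : X) 2 ^ a x (msg x).
  have : \sum_(x : X) 2 ^ (2 * q) * (a x (msg x)).+1 <=
      \sum_(x : X) (2 ^ a x (msg x) + 2 ^ (2 * q) * (2 * q)).
    by apply: leq_sum => x _; exact: exp2_tangent.
  rewrite big_split /= sum_nat_const cX -big_distrr /=.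
  under eq_bigr => x _ do rewrite -addn1.
  rewrite big_split /= sum1_card cX => h.
  have h2 : 2 ^ (2 * q) * (2 * q * 2 ^ (3 * q)) <=
      2 ^ (2 * q) * \sum_(x : X) a x (msg x).
    by rewrite leq_mul2l agr orbT.
  rewrite -(leq_add2r (2 ^ (3 * q) * (2 ^ (2 * q) * (2 * q)))).
  apply: leq_trans h; rewrite mulnDr addnC leq_add2r.
  by rewrite mulnCA (mulnC (2 ^ (3 * q))).
have main : 32 ^ q <= 3 ^ S * 27 ^ q.
  have := leq_trans lo up.
  by rewrite -expnD -mulnDl !expnM.
(* Fifth powers make the exponents comparable: [2 * 27 ^ 5 <= 32 ^ 5] yields the factor [2 ^ q], and
   [3 ^ 5 <= 2 ^ 8] the factor 8. *)
have : 2 ^ q * 27 ^ (5 * q) <= 2 ^ (8 * S) * 27 ^ (5 * q).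
  apply: (@leq_trans (32 ^ (5 * q))).
    rewrite (expnM 27) -expnMn (expnM 32).
    have le_expn b c : b <= c -> b ^ q <= c ^ q.
      by case: q {cT agr cX up lo main} => // q; rewrite leq_exp2r.
    exact/le_expn/double_exp5_le.
  have : (32 ^ q) ^ 5 <= (3 ^ S * 27 ^ q) ^ 5 by rewrite leq_exp2r.
  rewrite expnMn -(expnM 32) -(expnM 27) -(expnM 3) (mulnC q) => main5.
  apply: (leq_trans main5); rewrite leq_mul2r (mulnC S) !(expnM _ _ S).
  by apply/orP; right; case: (S) => // k; rewrite leq_exp2r.
by rewrite leq_pmul2r ?expn_gt0 // leq_exp2l.
Qed.

(** * Averaging over the random choices *)

Local Open Scope card_scope.
Local Open Scope classical_set_scope.
Local Open Scope ring_scope.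

(** The expected number of events that occur is the sum of their probabilities. This number takes
    finitely many values, so its maximum is attained, and the maximum is at least the
    expectation. *)
Lemma exists_outcome_in_many (R : realType) (d : measure_display)
    (Omega : measurableType d) (P : probability Omega R) (J : finType)
    (E : J -> set Omega) (p : R) :
  (forall j, measurable (E j) /\ (p%:E <= P (E j))%E) ->
  exists w, p * #|J|%:R <= (\sum_j (w \in E j))%:R.
Proof.
move=> EP.
pose hits w : nat := (\sum_j (w \in E j))%N.
have hitsJ w : (hits w <= #|J|)%N.
  by rewrite -sum1_card; apply: leq_sum => j _; exact: leq_b1.
have ex_hits : exists k, `[< exists w, hits w = k >].
  have /set0P[w _] : [set: Omega] != set0.
    apply/eqP => h; have := probability_setT P.
    by rewrite h measure0 => /eqP; rewrite eqe eq_sym oner_eq0.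
  by exists (hits w); apply/asboolP; exists w.
have bounded k : `[< exists w, hits w = k >] -> (k <= #|J|)%N.
  by move=> /asboolP[w <-].
case: (ex_maxnP ex_hits bounded) => k /asboolP[w <-] wmax; exists w.
rewrite -lee_fin.
apply: (@le_trans _ _ (\sum_j P (E j))%E).
  rewrite mulr_natr -sumr_const -sumEFin; apply: lee_sum => j _.
  by have [] := EP j.
have measE j : measurable_fun [set: Omega] (EFin \o (\1_(E j) : Omega -> R)).
  by apply/measurable_EFinP; apply: measurable_indic; have [] := EP j.
have -> : (\sum_j P (E j) = \int[P]_w0 \sum_j (\1_(E j) w0)%:E)%E.
  rewrite (@ge0_integral_sum _ _ _ P _ measurableT _
            (fun j => EFin \o \1_(E j))) //; last first.
    by move=> j w0 _; rewrite lee_fin.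
  apply: eq_bigr => j _; rewrite integral_indic ?setIT //.
  by have [] := EP j.
apply: (@le_trans _ _ (\int[P]_w0 (cst (hits w)%:R%:E w0))%E).
  apply: ge0_le_integral => //.
  - by move=> w0 _; apply: sume_ge0 => j _; rewrite lee_fin.
  - exact: emeasurable_sum.
  - move=> w0 _ /=.
    rewrite sumEFin lee_fin.
    under eq_bigr do rewrite indicE.
    rewrite -natr_sum ler_nat; apply: wmax; apply/asboolP; by exists w0.
by rewrite integral_cst //= [X in (_ * X)%E](@probability_setT _ _ _ P) mule1.
Qed.

(** * Discrepancy as a supremum of signed counts *)

Section stream_discrepancy.
Variable R : realType.
Implicit Types (s : seq (R * bool)) (I : interval R).

Definition signed_count s I : R :=
  \sum_(x <- s | x.1 \in I) (-1) ^+ (~~ x.2).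

Lemma color_count_signed s I :
  (color_count red s I)%:R - (color_count blue s I)%:R = signed_count s I.
Proof.
rewrite /color_count -!sum1_count !natr_sum /signed_count.
elim: s => [|[a b] s IH]; first by rewrite !big_nil subrr.
rewrite !big_cons -IH /=; case: (a \in I); case: b => //=; rewrite /= ?expr0 ?expr1; ring.
Qed.

Lemma signed_count_norm_le s I : `|signed_count s I| <= (size s)%:R.
Proof.
rewrite /signed_count; apply: (le_trans (ler_norm_sum _ _ _)).
under eq_bigr do rewrite normrX normrN1 expr1n -[1]/(1%:R).
by rewrite -natr_sum ler_nat sum1_count count_size.
Qed.

Lemma color_discrepancy_ge s I : [set` I] `<=` `[0, 1] ->
  `|signed_count s I| <= color_discrepancy s.
Proof.
move=> I01; apply: ub_le_sup; last by exists I => //; rewrite color_count_signed.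
exists (size s)%:R => _ [K _ <-]; rewrite color_count_signed.
exact: signed_count_norm_le.
Qed.

Lemma color_discrepancy_le s (C : R) :
  (forall I, `|signed_count s I| <= C) -> color_discrepancy s <= C.
Proof.
move=> h; apply: ge_sup; last by move=> _ [K _ <-]; rewrite color_count_signed.
(* The empty interval shows that the set under [sup] is nonempty. *)
exists `|(color_count red s `]0, 0[)%:R - (color_count blue s `]0, 0[)%:R|.
exists `]0, 0[ => //= x /=; rewrite in_itv => /andP[x0 /(lt_trans x0)].
by rewrite ltxx.
Qed.

End stream_discrepancy.

(** * Blocks of consecutive indices and increasing positions *)

Lemma convex_pred_interval (p : pred nat) (N : nat) :
  (forall i j k, (i <= j <= k)%N -> (k < N)%N -> p i -> p k -> p j) ->
  exists a b, [/\ (a <= b)%N, (b <= N)%N &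
                 forall j, (j < N)%N -> p j = (a <= j < b)%N].
Proof.
move=> pconv.
have [h|h] := pselect (exists k, (k < N)%N && p k); last first.
  exists 0, 0; split=> // j jN; rewrite ltn0 andbF.
  by apply/negP => pj; apply: h; exists j; rewrite jN.
have ub k : (k < N)%N && p k -> (k <= N)%N by move=> /andP[/ltnW].
exists (ex_minn h), (ex_maxn h ub).+1.
case: ex_minnP => a /andP[aN pa] amin; case: ex_maxnP => b /andP[bN pb] bmax.
split=> //; first by rewrite ltnW // ltnS amin // bN.
move=> j jN; apply/idP/idP => [pj|/andP[aj jb]].
  by rewrite amin ?jN //= ltnS bmax // jN.
by apply: pconv pa pb => //; rewrite aj.
Qed.

(** The selected indices form a block, and a block sum is a difference of two prefix sums, hence the
    doubled bound. *)
Lemma convex_sum_norm_le (R : numDomainType) (N : nat) (p : pred nat)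
    (f : nat -> R) (C : R) :
  (forall i j k, (i <= j <= k)%N -> (k < N)%N -> p i -> p k -> p j) ->
  (forall k, (k <= N)%N -> `|\sum_(0 <= j < k) f j| <= C) ->
  `|\sum_(0 <= j < N | p j) f j| <= C + C.
Proof.
move=> /convex_pred_interval[a [b [ab bN pE]]] fC.
have -> : \sum_(0 <= j < N | p j) f j = \sum_(a <= j < b) f j.
  rewrite [RHS](big_nat_widen _ _ N) // [RHS](big_nat_widenl _ 0) //.
  rewrite [LHS]big_nat_cond [RHS]big_nat_cond; apply: eq_bigl => j.
  rewrite leq0n /=; case jN: (j < N)%N => /=; last by [].
  by rewrite pE ?jN // andbC.
have -> : \sum_(a <= j < b) f j = \sum_(0 <= j < b) f j - \sum_(0 <= j < a) f j.
  by rewrite [X in X - _](big_cat_nat (leq0n a) ab) //= addrAC subrr add0r.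
by apply: (le_trans (ler_normB _ _)); apply: lerD; apply: fC => //; exact: leq_trans bN.
Qed.

Lemma increasing_positions (R : realType) (U : set R) (n : nat) :
  `I_n #<= U -> exists u : nat -> R,
    (forall j, (j < n)%N -> U (u j)) /\
    (forall i j, (i < j)%N -> (j < n)%N -> u i < u j).
Proof.
move=> /pcard_leP[g].
pose s := sort <=%O [seq g j | j <- iota 0 n].
have szs : size s = n by rewrite size_sort size_map size_iota.
have us : uniq s.
  rewrite sort_uniq map_inj_in_uniq ?iota_uniq // => i j.
  rewrite !mem_iota !add0n /= => iN jN /inj; apply; exact/mem_set.
exists (nth 0 s); split=> [j jn|i j ij jn].
  have : nth 0 s j \in s by rewrite mem_nth ?szs.
  rewrite mem_sort => /mapP[k]; rewrite mem_iota add0n => /= kn ->.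
  exact: funS.
have /(sorted_ltn_nth lt_trans) : sorted <%O s.
  by rewrite lt_sorted_uniq_le us sort_le_sorted.
by apply; rewrite ?inE ?szs // (ltn_trans ij).
Qed.

(** * The INDEX streams and their discrepancy *)

Definition pair_color (x : nat -> bool) (j : nat) : bool := x j./2 (+) odd j.

Definition alice_stream (R : realType) (u : nat -> R) (m : nat)
    (x : nat -> bool) : seq (R * bool) :=
  [seq (u j, pair_color x j) | j <- iota 0 m.*2].

(** The last [r] points are padding to reach a prescribed length. They alternate in color at a
    single position after all pairs, so their net weight is 0 or 1. *)
Definition bob_stream (R : realType) (u : nat -> R) (m r i : nat) :
    seq (R * bool) :=
  [:: (u i.*2, red); (u i.*2, red); (u i.*2.+1, blue); (u i.*2.+1, blue)] ++
  [seq (u m.*2, ~~ odd k) | k <- iota 0 r].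

(** Both streams put points on the same positions; merging them by position index turns interval
    counts into sums over consecutive indices. *)
Definition net_weight (R : realType) (m r i : nat) (x : nat -> bool) (j : nat)
    : R :=
  if j == m.*2 then (odd r)%:R else
  (-1) ^+ (~~ pair_color x j) + (if j == i.*2 then 2 else 0)
    - (if j == i.*2.+1 then 2 else 0).

Lemma signed_count_protocol (R : realType) (u : nat -> R) (m r i : nat)
    (x : nat -> bool) (I : interval R) : (i < m)%N ->
  signed_count (alice_stream u m x ++ bob_stream u m r i) I =
  \sum_(0 <= j < m.*2.+1 | u j \in I) net_weight R m r i x j.
Proof.
move=> im; rewrite /signed_count big_cat.
have -> : \sum_(y <- alice_stream u m x | y.1 \in I) (-1) ^+ (~~ y.2) =
    \sum_(0 <= j < m.*2 | u j \in I) (-1) ^+ (~~ pair_color x j) :> R.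
  by rewrite big_map /index_iota subn0.
have padE : (\sum_(y <- [seq (u m.*2, ~~ odd k) | k <- iota 0 r] | y.1 \in I)
     (-1) ^+ (~~ y.2)) = (if u m.*2 \in I then (odd r)%:R else 0) :> R.
  elim: r => [|r IH]; first by rewrite big_nil if_same.
  rewrite -addn1 iotaD map_cat big_cat IH /= big_cons big_nil /= add0n addn1 /=.
  case: ifP => _; rewrite ?addr0 //; case: (odd r) => /=; rewrite ?expr0 ?expr1; ring.
have -> : \sum_(y <- bob_stream u m r i | y.1 \in I) (-1) ^+ (~~ y.2) =
    (if u i.*2 \in I then 2 else 0) - (if u i.*2.+1 \in I then 2 else 0)
    + (if u m.*2 \in I then (odd r)%:R else 0) :> R.
  rewrite big_cat padE !big_cons big_nil /= expr0 expr1.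
  by congr (_ + _); case: (u i.*2 \in I); case: (u i.*2.+1 \in I); ring.
rewrite [RHS]big_mkcond [RHS]big_nat_recr // [in X in _ = _ + X]/net_weight eqxx.
rewrite /= addrA; congr (_ + _).
transitivity (\sum_(0 <= j < m.*2 | u j \in I) 
   ((-1) ^+ (~~ pair_color x j) + (if j == i.*2 then 2 else 0)
    - (if j == i.*2.+1 then 2 else 0)) : R); last first.
  rewrite [LHS]big_mkcond; apply: eq_big_nat => j /andP[_ jm].
  by rewrite /net_weight (ltn_eqF jm).
rewrite big_split big_split /= sumrN -!big_mkcondr !big_nat1_cond_eq.
have -> : (i.*2 < m.*2)%N by rewrite ltn_double.
have -> : (i.*2.+1 < m.*2)%N by rewrite -doubleS; lia.
by rewrite addrA.
Qed.

(** Complete pairs cancel; an odd prefix leaves the left point of an unfinished pair. *)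
Lemma pair_color_prefix_sum (R : realType) (y : nat -> bool) (k : nat) :
  \sum_(0 <= j < k) (-1) ^+ (~~ pair_color y j) =
  (if odd k then (-1) ^+ (~~ y k./2) else 0) :> R.
Proof.
elim: k => [|k IH]; first by rewrite big_nil.
rewrite big_nat_recr // IH /= /pair_color uphalf_half.
case: (odd k) => /=; last by rewrite !add0r addbF.
by rewrite addbT; case: (y _); rewrite /= expr0 expr1 ?subrr ?addNr.
Qed.

(* Where bit i is 0, the query flips the signs of pair i, so the net weights
   are again those of a sequence of balanced pairs. *)
Lemma net_weight_bit0 (R : realType) (m r i : nat) (x : nat -> bool) (j : nat) :
  x i = false -> (j < m.*2)%N ->
  net_weight R m r i x j =
  (-1) ^+ (~~ pair_color (fun k => x k || (k == i)) j).
Proof.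
move=> xi jm; rewrite /net_weight (ltn_eqF jm) /pair_color.
have [->|j0] := eqVneq j i.*2.
  rewrite doubleK odd_double xi eqxx /= ltn_eqF // expr0 expr1; ring.
have [->|j1] := eqVneq j i.*2.+1.
  rewrite /= uphalf_double odd_double xi eqxx /= expr0 expr1; ring.
have -> : (j./2 == i) = false by apply/eqP; lia.
by rewrite addr0 subr0 orbF.
Qed.

Lemma net_weight_prefix_le1 (R : realType) (m r i : nat) (x : nat -> bool)
    (k : nat) : x i = false -> (k <= m.*2.+1)%N ->
  `|\sum_(0 <= j < k) net_weight R m r i x j| <= 1.
Proof.
move=> xi; rewrite leq_eqVlt ltnS => /predU1P[->|km].
  (* At full length all pairs have cancelled and only the padding remains. *)
  rewrite big_nat_recr // (eq_big_nat _ _ (fun j jm => net_weight_bit0 _ _ xi _)) //=.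
  rewrite pair_color_prefix_sum odd_double add0r /net_weight eqxx.
  by case: (odd r); rewrite ?normr1 ?normr0.
rewrite (eq_big_nat _ _ (F2 := fun j =>
    (-1) ^+ (~~ pair_color (fun k => x k || (k == i)) j))); last first.
  move=> j /andP[_ jk]; apply: net_weight_bit0 => //; exact: leq_trans km.
rewrite pair_color_prefix_sum; case: ifP; rewrite ?normr0 //.
by rewrite normrX normrN1 expr1n.
Qed.

Lemma color_discrepancy_bit0 (R : realType) (u : nat -> R) (m r i : nat)
    (x : nat -> bool) :
  (forall j k, (j < k)%N -> (k <= m.*2)%N -> u j < u k) ->
  (i < m)%N -> x i = false ->
  color_discrepancy (alice_stream u m x ++ bob_stream u m r i) <= 2.
Proof.
move=> umono im xi; apply: color_discrepancy_le => I.
rewrite signed_count_protocol //.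
have -> : 2 = 1 + 1 :> R by [].
apply: convex_sum_norm_le; last by move=> k; exact: net_weight_prefix_le1.
move=> j k l /andP[jk kl]; rewrite ltnS => lm jI lI.
have ule a b : (a <= b)%N -> (b <= m.*2)%N -> u a <= u b.
  by rewrite leq_eqVlt => /predU1P[-> //|ab bm]; apply/ltW/umono.
have /(_ (u k)) := interval_is_interval jI lI.
by apply; rewrite !ule // (leq_trans kl).
Qed.

Lemma color_discrepancy_bit1 (R : realType) (u : nat -> R) (m r i : nat)
    (x : nat -> bool) :
  (forall j k, (j < k)%N -> (k <= m.*2)%N -> u j < u k) ->
  (forall j, (j <= m.*2)%N -> `[0, 1]%classic (u j)) ->
  (i < m)%N -> x i = true ->
  3 <= color_discrepancy (alice_stream u m x ++ bob_stream u m r i).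
Proof.
move=> umono u01 im xi.
have i2m : (i.*2 < m.*2)%N by rewrite ltn_double.
(* By strict monotonicity this degenerate interval selects only the index [i.*2], of weight 1 +
   2. *)
apply: le_trans (color_discrepancy_ge _ (I := `[u i.*2, u i.*2]) _); last first.
  by rewrite set_itv1 => _ ->; apply: u01; exact: ltnW.
rewrite signed_count_protocol //.
rewrite big_nat_cond (eq_bigl (fun j => (0 <= j < m.*2.+1)%N && (j == i.*2))).
  rewrite -big_nat_cond big_nat1_eq leq0n ltnS ltnW //=.
  rewrite /net_weight (ltn_eqF i2m) eqxx /pair_color doubleK odd_double xi /=.
  rewrite ltn_eqF // expr0 ger0_norm; lra.
move=> j; case jm: (j < m.*2.+1)%N; rewrite leq0n //=.
rewrite in_itv /= -eq_le; apply/eqP/eqP => [uE|-> //].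
case: (ltngtP j i.*2) => // h.
  by have := umono _ _ h (ltnW i2m); rewrite uE ltxx.
by have := umono _ _ h jm; rewrite uE ltxx.
Qed.

(** * Decoding INDEX from the memory *)

Lemma run_from_cat (R : realType) (Omega : Type)
    (A : streaming_algorithm R Omega) (w : Omega) (t : nat) (z : seq bool)
    (s s' : seq (R * bool)) :
  run_from A w t z (s ++ s') =
  run_from A w (t + size s) (run_from A w t z s) s'.
Proof.
by elim: s t z => [|a s IH] t z /=; rewrite ?addn0 // IH addnS addSn.
Qed.

(** The threshold is 12/5 = 2 (1 + 1/5) = 3 (1 - 1/5), where the two error ranges would meet at
    [eps = 1 / 5]. *)
Lemma threshold_decodes (R : realType) (eps D' D : R) (b : bool) :
  0 < eps -> eps < 1 / 5 -> `|D' - D| <= eps * D ->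
  (b = false -> D <= 2) -> (b = true -> 3 <= D) -> b = (12 / 5 < D').
Proof.
move=> e0 e5; rewrite ler_norml => /andP[lo hi].
case: b => [_ /(_ erefl) h|/(_ erefl) h _].
  by apply/esym; nra.
by apply/esym/negbTE; rewrite -leNgt; nra.
Qed.

Section index_reduction.
Variables (R : realType) (eps : R) (U : set R) (n m : nat) (u : nat -> R).
Hypotheses (eps_gt0 : 0 < eps) (eps_lt : eps < 1 / 5) (U01 : U `<=` `[0, 1]).
Hypotheses (umono : forall j k, (j < k)%N -> (k <= m.*2)%N -> u j < u k)
           (uU : forall j, (j <= m.*2)%N -> U (u j)) (mn : (m.*2 + 4 <= n)%N).

Let bits (x : {ffun 'I_m -> bool}) (k : nat) : bool :=
  if insub k is Some i then x i else false.

Let bitsE x (i : 'I_m) : bits x i = x i.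
Proof. by rewrite /bits valK. Qed.

Let protocol (x : {ffun 'I_m -> bool}) (i : 'I_m) :=
  alice_stream u m (bits x) ++ bob_stream u m (n - (m.*2 + 4)) i.

Let size_alice x : size (alice_stream u m x) = m.*2.
Proof. by rewrite size_map size_iota. Qed.

Let protocol_streams x i : streams U n (protocol x i).
Proof.
split; first by rewrite /protocol size_cat size_alice /= size_map size_iota; lia.
have im : (i.*2 < m.*2)%N by rewrite ltn_double.
have im1 : (i.*2.+1 < m.*2)%N by lia.
move=> p; rewrite mem_cat => /orP[/mapP[j]|].
  by rewrite mem_iota add0n => jm ->; apply/uU/ltnW.
rewrite mem_cat => /orP[|/mapP[j _ ->]]; last exact: uU.
by rewrite !inE => /or4P[] /eqP->; apply/uU/ltnW.
Qed.

Lemma index_bits_le_space (q S : nat) (d : measure_display)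
    (Omega : measurableType d) (P : probability Omega R)
    (A : streaming_algorithm R Omega) :
  m = (3 * q)%N -> multiplicative_solution P A eps (1 / 3) U n ->
  (forall w s k, streams U n s -> (size (memory A w (take k s)) <= S)%N) ->
  (q <= 8 * S)%N.
Proof.
move=> mE sol szS.
case: q mE => [//|q'] mE; set q := q'.+1 in mE *.
(* Some index is needed to complete Alice's part to a stream of length [n], to which the space bound
   applies. *)
pose i0 : 'I_m := cast_ord (esym mE) ord0.
pose E (xi : {ffun 'I_m -> bool} * 'I_m) := success A eps (protocol xi.1 xi.2).
have [xi|w Ew] := @exists_outcome_in_many R d Omega P _ E (1 - 1 / 3).
  by apply: sol; exact: protocol_streams.
(* The run resumes at time [m.*2] with the fixed coins [w], exactly as in the full stream, so the
   guess depends on [x] only through the memory. *)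
pose guess z : {ffun 'I_m -> bool} := [ffun i : 'I_m =>
  12 / 5 < sa_output A w
    (run_from A w m.*2 z (bob_stream u m (n - (m.*2 + 4)) i))].
pose msg x := memory A w (alice_stream u m (bits x)).
have decoded x i : w \in E (x, i) -> x i == guess (msg x) i.
  rewrite inE /E /success /= ffunE => succ; apply/eqP.
  have <- : output A w (protocol x i) = sa_output A w
      (run_from A w m.*2 (msg x) (bob_stream u m (n - (m.*2 + 4)) i)).
    by rewrite /output /memory run_from_cat size_alice.
  apply: threshold_decodes eps_gt0 eps_lt succ _ _ => xi.
    by apply: color_discrepancy_bit0; rewrite ?bitsE.
  apply: color_discrepancy_bit1; rewrite ?bitsE // => j jm.
  exact/U01/uU.
apply: (@index_memory_lower_bound S q 'I_m msg guess).
- by rewrite card_ord.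
- move=> x; have := szS w (protocol x i0) m.*2 (protocol_streams x i0).
  by rewrite take_size_cat // size_alice.
apply: (@leq_trans (\sum_xi (w \in E xi))).
  rewrite -(ler_nat R); apply: le_trans Ew.
  rewrite card_prod card_ffun card_bool card_ord mE !natrM; lra.
have -> : (\sum_xi (w \in E xi) = \sum_x \sum_i (w \in E (x, i)))%N.
  by rewrite pair_bigA.
apply: leq_sum => x _; rewrite -sum1_card [leqRHS]big_mkcond /=.
apply: leq_sum => i _; rewrite unfold_in /=; have := @decoded x i.
by case: (w \in _) => // /(_ isT) ->.
Qed.

End index_reduction.

Theorem theorem22 (R : realType) (eps : R) (eps_gt0 : 0 < eps)
    (eps_lt : eps < 1 / 5) :
  exists2 c : R, 0 < c & exists n0 : nat, forall n : nat, (n0 <= n)%N ->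
    forall U : set R, U `<=` `[0, 1] -> `I_n #<= U ->
    forall (d : measure_display) (Omega : measurableType d)
      (P : probability Omega R) (A : streaming_algorithm R Omega),
      multiplicative_solution P A eps (1 / 3) U n ->
      ((c * n%:R)%:E <= space_bits A U n)%E.
Proof.
exists (1 / 100); first by lra.
exists 100%N => n n100 U U01 cardU d Omega P A sol.
have [u [uU umono]] := increasing_positions cardU.
rewrite leNgt; apply/negP => small.
(* The [3 * q] pairs take [6 * q] points and the query takes 4. If the space were below [n / 100],
   integrality would bound it by [S], but [q], about [n / 6], exceeds [8 * S] once [n >= 100]. *)
pose q := ((n - 4) %/ 6)%N; pose S := (n %/ 100)%N.
suff : (q <= 8 * S)%N by rewrite /q /S; lia.
have bound : ((3 * q).*2 + 4 <= n)%N by rewrite /q; lia.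
apply: (@index_bits_le_space R eps U n (3 * q) u eps_gt0 eps_lt U01 _ _ _
          q S d Omega P A erefl sol).
- by move=> j k jk km; apply: umono => //; lia.
- by move=> j jm; apply: uU; lia.
- exact: bound.
move=> w s k sU.
have : ((size (memory A w (take k s)))%:R%:E < (1 / 100 * n%:R)%:E :> \bar R)%E.
  by apply: le_lt_trans small; apply: ereal_sup_ubound; exists w, s, k.
rewrite lte_fin => h; rewrite /S leq_divRL // -(ler_nat R) natrM; lra.
Qed.
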